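(* There exists a subspace of $\beta\omega$ which is $k$-countably compact for every $k\in\omega$ but not $2$-cascade countably compact.
   Context: $\beta\omega$ is the Stone–Čech compactification of the discrete space $\omega$. For infinite $M\subseteq\omega$ and $k\in\omega$, $[M]^k$ is the set of $k$-element subsets of $M$ (so $[M]^0=\{\emptyset\}$), and $m+1=\{0,\dots,m\}$. For a free ultrafilter $p$ on $\omega$ with $M\in p$, define the filter $p^{[M]^k}$ on $[M]^k$ recursively: $p^{[M]^0}=\{\{\emptyset\}\}$; for $k>0$, $p^{[M]^k}$ is the set of all $A\subseteq[M]^k$ such that $\{m\in M:\{s\in[M\setminus(m+1)]^{k-1}:\{m\}\cup s\in A\}\in p^{[M\setminus(m+1)]^{k-1}}\}\in p$. A space $X$ is $k$-countably compact if for every $f:[\omega]^k\to X$ there are a free ultrafilter $p$ on $\omega$ and $x\in X$ such that $\{s\in[\omega]^k:f(s)\in U\}\in p^{[\omega]^k}$ for every neighborhood $U$ of $x$. If $p$ is a free ultrafilter on $\omega$, $A\in p$ and $(x_m:m\in A)$ is a family in $X$, then $x\in X$ is a $p$-limit of it if $\{m\in A:x_m\in U\}\in p$ for every neighborhood $U$ of $x$. A space $X$ is $2$-cascade countably compact (also called doubly countably compact) if for every $f:[\omega]^2\to X$ there are a free ultrafilter $p$ on $\omega$, a set $A\in p$, points $x_n\in X$ for $n\in A$, and $x\in X$ such that for every $n\in A$, $x_n$ is a $p$-limit of $(f(\{n,m\}):m>n)$, and $x$ is a $p$-limit of $(x_n:n\in A)$. *)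

(* Defs.v *)
From HB Require Import structures.
From mathcomp Require Import all_boot all_order finmap.
From mathcomp Require Import all_classical topology.

Set Implicit Arguments.
Unset Strict Implicit.
Unset Printing Implicit Defensive.


Local Open Scope classical_set_scope.

(* The Stone-Cech compactification of the discrete space nat, realised as the
   space of ultrafilters on nat with the sets {p | A \in p}, for A a subset of
   nat, as a base of open sets.  That this is the Stone-Cech compactification is
   beta_omega_compact, beta_omega_hausdorff, beta_principal_inj,
   beta_principal_open, beta_principal_dense and beta_omega_extension. *)
Record beta_omega : Type := BetaOmega {
  mem_beta : set_system nat;
  beta_ultra : UltraFilter mem_beta }.

Existing Instance beta_ultra.

HB.instance Definition _ := gen_eqMixin beta_omega.
HB.instance Definition _ := gen_choiceMixin beta_omega.

Definition clopen_of (A : set nat) : set beta_omega := [set p | mem_beta p A].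

Lemma clopen_of_cover : \bigcup_(A in setT) clopen_of A = setT.
Proof. by apply/seteqP; split=> // p _; exists setT => //; exact: filterT. Qed.

Lemma clopen_of_join (A B : set nat) (p : beta_omega) :
  setT A -> setT B -> clopen_of A p -> clopen_of B p ->
  exists C, [/\ setT C, clopen_of C p & clopen_of C `<=` clopen_of A `&` clopen_of B].
Proof.
move=> _ _ pA pB; exists (A `&` B); split=> //; first exact: filterI.
by move=> q qAB; split; apply: filterS qAB => n [].
Qed.

HB.instance Definition _ :=
  isBaseTopological.Build beta_omega clopen_of_cover clopen_of_join.

Definition beta_principal (n : nat) : beta_omega :=
  BetaOmega (principal_filter_ultra n).

Lemma ultra_setVsetC (F : set_system nat) :
  ProperFilter F -> (forall A, F A \/ F (~` A)) -> UltraFilter F.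
Proof.
move=> FF FVC; split=> // G GG FG; apply/seteqP; split=> // A GA.
case: (FVC A) => // /FG GnA.
by have [x []] := filter_ex (filterI GA GnA).
Qed.

Lemma beta_omega_eqP (p q : beta_omega) :
  mem_beta p `<=` mem_beta q -> p = q.
Proof.
case: p q => [p pU] [q qU] /= pq.
have qp : q = p by apply: max_filter pq.
by subst q; congr BetaOmega; exact: Prop_irrelevance.
Qed.

Lemma open_clopen_of (A : set nat) : open (clopen_of A).
Proof. by exists [set A]; rewrite ?bigcup_set1. Qed.

Lemma nbhs_beta_omega (p : beta_omega) (U : set beta_omega) :
  nbhs p U <-> exists2 A : set nat, mem_beta p A & clopen_of A `<=` U.
Proof.
split; last first.
  move=> [A pA AU]; apply: filterS AU _.
  by apply: open_nbhs_nbhs; split=> //; exact: open_clopen_of.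
rewrite nbhsE => -[B [[D _ <-] [A DA pA]] BU].
by exists A => // q qA; apply: BU; exists A.
Qed.

Lemma beta_omega_compact : compact [set: beta_omega].
Proof.
rewrite compact_ultra => F FU _.
pose p : set_system nat := [set A | F (clopen_of A)].
have pF : ProperFilter p.
  apply: Build_ProperFilter_ex.
    by move=> A /(@filter_ex _ F)[q]; exact: (@filter_ex _ (mem_beta q)).
  split.
  - by apply: (@filterS _ F) filterT => q _; exact: (@filterT _ (mem_beta q)).
  - move=> A B FA FB; apply: (@filterS _ F) (@filterI _ F _ _ _ FA FB) => q [].
    exact: (@filterI _ (mem_beta q)).
  - move=> A B AB; apply: (@filterS _ F) => q.
    exact: (@filterS _ (mem_beta q)).
have pU : UltraFilter p.
  apply: ultra_setVsetC => A.
  have [|FnA] := in_ultra_setVsetC (clopen_of A) FU; [by left|right].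
  apply: filterS FnA => q nqA.
  by have [] := in_ultra_setVsetC A (beta_ultra q).
exists (BetaOmega pU); split=> // U /nbhs_beta_omega[A FA AU].
exact: (@filterS _ F _ _ _ AU FA).
Qed.

Lemma beta_omega_hausdorff : hausdorff_space beta_omega.
Proof.
move=> p q pq; apply: beta_omega_eqP => A pA.
have [//|qnA] := in_ultra_setVsetC A (beta_ultra q).
have np : nbhs p (clopen_of A) by apply/nbhs_beta_omega; exists A.
have nq : nbhs q (clopen_of (~` A)) by apply/nbhs_beta_omega; exists (~` A).
have [r [rA rnA]] := pq _ _ np nq.
by have [x []] := filter_ex (filterI rA rnA).
Qed.

Lemma beta_principal_inj : injective beta_principal.
Proof.
move=> m n mn; have : mem_beta (beta_principal m) [set m].
  by apply/principal_filterP.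
by rewrite mn => /principal_filterP.
Qed.

Lemma beta_principal_open (n : nat) : open [set beta_principal n].
Proof.
rewrite (_ : [set _] = clopen_of [set n]); first exact: open_clopen_of.
apply/seteqP; split=> [_ ->|p pn]; first exact/principal_filterP.
apply: esym; apply: beta_omega_eqP => A /principal_filterP An.
by apply: filterS pn => _ ->.
Qed.

Lemma beta_principal_dense : dense (range beta_principal).
Proof.
move=> O [p Op] oO.
have /nbhs_beta_omega[A pA AO] : nbhs p O by exact: open_nbhs_nbhs.
have [n An] := filter_ex pA.
by exists (beta_principal n); split; [apply: AO; exact/principal_filterP|exists n].
Qed.

Lemma beta_omega_extension (K : topologicalType) (f : nat -> K) :
  compact [set: K] -> hausdorff_space K ->
  exists! g : beta_omega -> K,
    continuous g /\ forall n, g (beta_principal n) = f n.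
Proof.
move=> cptK hK; have := cptK; rewrite compact_ultra => cK.
have fU (p : beta_omega) : UltraFilter (f @ mem_beta p).
  split=> [|G GG fG]; first exact: fmap_proper_filter.
  apply/seteqP; split=> // A GA.
  have [//|pnA] := in_ultra_setVsetC (f @^-1` A) (beta_ultra p).
  have GnA : G (~` A) by exact: fG.
  by have [y []] := filter_ex (filterI GA GnA).
have fcvg (p : beta_omega) : exists x : K, f @ mem_beta p --> x.
  by have [x [_ fx]] := cK _ (fU p) filterT; exists x.
have [g gE] := choice fcvg.
have gc : continuous g.
  move=> p U gU; have [V gV VU] := compact_regular hK cptK filterT gU.
  apply/nbhs_beta_omega; exists (f @^-1` V); first exact: gE.
  move=> q qV; apply: VU => W gW; have qW := gE q _ gW.
  by have [n [Vn Wn]] := filter_ex (filterI qV qW); exists (f n).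
have gf n : g (beta_principal n) = f n.
  apply: (cvg_unique hK (gE (beta_principal n))).
  move=> U fnU; apply: (principal_filterP n (f @^-1` U)).2.
  exact: (nbhs_singleton fnU).
exists g; split=> // h [hc hf]; apply/funext => p; apply: hK => U V gU hV.
have /nbhs_beta_omega[A pA AU] := gc p _ gU.
have /nbhs_beta_omega[B pB BV] := hc p _ hV.
have [n [An Bn]] := filter_ex (filterI pA pB); exists (f n); split.
- by rewrite -gf; apply: AU; exact/principal_filterP.
- by rewrite -hf; apply: BV; exact/principal_filterP.
Qed.

(* [M]^k *)
Definition ksubsets (M : set nat) (k : nat) : set {fset nat} :=
  [set s | [set` s] `<=` M /\ #|` s| = k].

Definition free_ultrafilter (p : set_system nat) : Prop :=
  UltraFilter p /\ \bigcap_(A in p) A = set0.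

(* The filter p^{[M]^k} on [M]^k, as a family of subsets of [M]^k; `I_m.+1 is
   {0, ..., m}. *)
Fixpoint power_filter (p : set_system nat) (M : set nat) (k : nat) :
    set (set {fset nat}) :=
  if k is k'.+1 then
    [set A | A `<=` ksubsets M k /\
       p [set m | M m /\
            power_filter p (M `\` `I_m.+1) k'
              [set s | ksubsets (M `\` `I_m.+1) k' s /\ A (m |` s)%fset]]]
  else [set [set fset0]].

Definition k_countably_compact (k : nat) (X : topologicalType) : Prop :=
  forall f : ksubsets setT k -> X,
  exists (p : set_system nat) (x : X), free_ultrafilter p /\
    forall U : set X, nbhs x U ->
      power_filter p setT k (set_val @` (f @^-1` U)).

Definition p_limit (p : set_system nat) (X : topologicalType) (A : set nat)
    (y : A -> X) (x : X) : Prop :=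
  forall U : set X, nbhs x U -> p (set_val @` (y @^-1` U)).

Lemma ksubsets_pair (n m : nat) : (n < m)%N -> ksubsets setT 2 [fset n; m]%fset.
Proof. by move=> nm; split=> //; rewrite cardfs2 (ltn_eqF nm). Qed.

Definition upair (n : nat) (m : [set m | (n < m)%N]) : ksubsets setT 2 :=
  SigSub (mem_set (ksubsets_pair (set_valP m))).

Definition two_cascade_countably_compact (X : topologicalType) : Prop :=
  forall f : ksubsets setT 2 -> X,
  exists (p : set_system nat) (A : set nat) (y : A -> X) (x : X),
    [/\ free_ultrafilter p,
        p A,
        forall n : A, p_limit p (fun m => f (@upair (set_val n) m)) (y n) &
        p_limit p y x].

(* Main.v *)
Require Import Defs.
From mathcomp Require Import all_boot all_order finmap.
From mathcomp Require Import all_classical topology.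
From mathcomp Require wochoice.
From Stdlib Require Wellfounded.

Set Implicit Arguments.
Unset Strict Implicit.
Unset Printing Implicit Defensive.

Local Open Scope classical_set_scope.

(** Code each pair {n < m} by a natural number, and let the n-th column be the
set of codes of the pairs with minimum n; the columns are disjoint.  On the
n-th column the code is determined by m, so an ultrafilter x containing this
column amounts to its image under m, an ultrafilter again.  The space X
consists of the x such that, whenever the n-th column is in x, this image is
principal or lies in P n, where P 0, P 1, ... are disjoint sets of ultrafilters
to be chosen.

X is not 2-cascade countably compact: map {n < m} to the principal ultrafilter
at its code.  If the limits along a free ultrafilter p of the rows
m |-> f {n, m} were in X for all n in some A in p, then, the image of the n-th
of these limits being p itself, p would be in P n for all n in A; but A has two
elements and the sets P n are disjoint.

X is k-countably compact as soon as each P n is so rich that it contains some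
power limit of every f : [omega]^k -> beta omega constant on no [M]^k with M
infinite.  Indeed a Ramsey argument reduces to the case where the values of f
either all contain one column, so that the richness of P n applies to their
images, or avoid the columns in a way that passes to the limit.

Such disjoint P n are found as in the construction of a Bernstein set, by
transfinite recursion over all (n, k, M, f) (distinct_representatives): there
are 2^c of them, so it is enough that such an f has 2^c power limits.  This
follows from the dichotomy constant_or_labelled: after restriction to an
infinite M, either f is constant on [M]^k or there is b : omega -> omega which
pushes f s forward to an element of s for all s in [M]^k.  In the second case b
pushes the limit of f along the k-th power of p forward to p whenever M is in p
(labelled_power_lim), so distinct p give distinct limits; and M belongs to 2^c
free ultrafilters (independent_points).

The dichotomy is proved by induction on k.  By Ramsey's theorem and fusion, f is
either independent of the largest element of s or injective in it; the first
case reduces k.  In the second (last_inj_labelled) the infinite set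
M = {m_0 < m_1 < ...} is built with sets B_i which belong to all f s with
max s = m_i and to no f s for s with a later maximum; b x is the least m_i with
x in B_i.  The sets B_i exist because beta omega has no nontrivial convergent
sequences; for functions of several variables this becomes last_inj_avoid. *)

(** * Fusion of infinite sets of natural numbers *)

Lemma infinite_inj_image (T U : Type) (h : T -> U) (M : set T) :
  injective h -> infinite_set M -> infinite_set (h @` M).
Proof.
move=> hI Minf; rewrite (@eq_finite_set _ _ _ M) //.
by apply: inj_card_eq => x y _ _; exact: hI.
Qed.

Lemma infinite_enum (M : set nat) :
  infinite_set M -> exists2 e : nat -> nat, injective e & forall n, M (e n).
Proof.
move=> /infiniteP/ppcard_leP[e]; exists e => [i j|n]; last exact: funS.
by move/inj; apply; rewrite in_setT.
Qed.

(** Diagonalization: if every infinite set can be shrunk to meet the requirement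
attached to any given m, a decreasing sequence of infinite sets, each obtained
by meeting the requirement of an element of the previous one, has an infinite
diagonal that meets the requirements of all its own elements. *)
Lemma fusion (Phi : nat -> set nat -> Prop) (N0 : set nat) :
  infinite_set N0 ->
  (forall m (N N' : set nat), N' `<=` N -> Phi m N -> Phi m N') ->
  (forall m (N : set nat), N0 m -> N `<=` N0 -> infinite_set N ->
    exists N', [/\ N' `<=` N, infinite_set N' & Phi m N']) ->
  exists M, [/\ M `<=` N0, infinite_set M &
    forall m, M m -> Phi m [set n | M n /\ (m < n)%N]].
Proof.
move=> N0inf PhiS Phid.
have step (N : set nat) : exists mN : nat * set nat,
    N `<=` N0 -> infinite_set N ->
    [/\ N mN.1, mN.2 `<=` N, infinite_set mN.2, Phi mN.1 mN.2
      & forall n, mN.2 n -> (mN.1 < n)%N].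
  have [[NN0 Ninf]|nN] := pselect (N `<=` N0 /\ infinite_set N); last first.
    by exists (0%N, set0) => ? ?; case: nN.
  have [m Nm] := infinite_setN0 Ninf.
  have [||N' [N'N N'inf PhiN']] := Phid m (N `\` `I_m.+1) (NN0 _ Nm).
  - by move=> n [/NN0].
  - exact/infinite_setD/finite_II.
  exists (m, N') => _ _; split=> //= n /N'N[] //=.
  by rewrite ltnS leqNgt => _ /negP; rewrite negbK.
have [F FP] := choice step.
pose S j := iter j (fun N => (F N).2) N0.
have Sinv j : S j `<=` N0 /\ infinite_set (S j).
  elim: j => [|j [SjN0 Sjinf]]; first by split.
  have [_ sub inf _ _] := FP _ SjN0 Sjinf.
  by split=> //; apply: subset_trans SjN0.
have SP j := FP _ (Sinv j).1 (Sinv j).2.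
have Santi j i : S (i + j) `<=` S j.
  elim: i => // i; apply: subset_trans.
  by have [_ sub _ _ _] := SP (i + j); rewrite addSn.
pose m j := (F (S j)).1.
have mS i j : (j <= i)%N -> S j (m i).
  move=> ji; apply: (Santi j (i - j)); rewrite subnK //.
  by have [] := SP i.
have mlt i j : (j < i)%N -> (m j < m i)%N.
  by have [_ _ _ _ ltS] := SP j; move=> /mS/ltS.
have mI : injective m.
  move=> i j mij; apply/eqP; rewrite eqn_leq; apply/andP; split.
    by rewrite leqNgt; apply/negP => /mlt; rewrite mij ltnn.
  by rewrite leqNgt; apply/negP => /mlt; rewrite mij ltnn.
exists (range m); split.
- by move=> _ [j _ <-]; apply: (Sinv 0).1; apply: mS.
- exact/infinite_inj_image/infinite_nat.
- move=> _ [j _ <-]; have [_ _ _ + _] := SP j; apply: PhiS.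
  move=> _ [[i _ <-]] mji; apply: (mS i j.+1); rewrite ltnNge.
  apply/negP; rewrite leq_eqVlt => /orP[/eqP ij|/mlt]; last first.
    by rewrite ltnNge (ltnW mji).
  by rewrite ij ltnn in mji.
Qed.

Definition beyond (M : set nat) (s : {fset nat}) : set nat :=
  [set n | M n /\ forall x, x \in s -> (x < n)%N].

(** For requirements inherited by subsets, finitely many can be met one after
the other. *)
Lemma shrink_all (I : eqType) (Psi : I -> set nat -> Prop) (r : seq I)
    (N : set nat) :
  (forall i (N N' : set nat), N' `<=` N -> Psi i N -> Psi i N') ->
  (forall i (N' : set nat), i \in r -> N' `<=` N -> infinite_set N' ->
    exists N'', [/\ N'' `<=` N', infinite_set N'' & Psi i N'']) ->
  infinite_set N ->
  exists N', [/\ N' `<=` N, infinite_set N' & forall i, i \in r -> Psi i N'].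
Proof.
move=> PsiS + Ninf; elim: r => [_|i r IH dense].
  by exists N; split=> //; exact: subset_refl.
have [j N' jr|N' [N'N N'inf N'r]] := IH.
  by apply: dense; rewrite inE jr orbT.
have [|N'' [N''N' N''inf N''i]] := dense i N' _ N'N N'inf.
  by rewrite inE eqxx.
exists N''; split=> //; first exact: subset_trans N'N.
move=> j; rewrite inE => /predU1P[->//|/N'r jN'].
exact: PsiS N''N' jN'.
Qed.

Lemma fset_maxP (s : {fset nat}) : s != fset0 ->
  exists2 m, m \in s & forall x, x \in s -> (x <= m)%N.
Proof.
move=> /fset0Pn[x0 x0s].
have sB x : x \in s -> (x <= \max_(y <- s) y)%N.
  by move=> xs; exact: leq_bigmax_seq.
by case: (ex_maxnP (ex_intro _ x0 x0s) sB) => m ms mmax; exists m.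
Qed.

(** Fusion with requirements attached to finite sets s, to be met beyond s: at
step m meet those of the finitely many s included in {0, ..., m}. *)
Lemma fusion_fset (Psi : {fset nat} -> set nat -> Prop) (N0 : set nat) :
  infinite_set N0 ->
  (forall (s : {fset nat}) (N N' : set nat),
    N' `<=` N -> Psi s N -> Psi s N') ->
  (forall (s : {fset nat}) (N : set nat),
    [set` s] `<=` N0 -> N `<=` N0 -> infinite_set N ->
    exists N', [/\ N' `<=` N, infinite_set N' & Psi s N']) ->
  exists M, [/\ M `<=` N0, infinite_set M &
    forall s : {fset nat}, [set` s] `<=` M -> Psi s (beyond M s)].
Proof.
move=> N0inf PsiS Psid.
have [|N1 [N1N0 N1inf N1E]] := Psid fset0 N0 _ (@subset_refl _ _) N0inf.
  by move=> x /=; rewrite inE.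
pose low m : {fset {fset nat}} := fpowerset (seq_fset tt (iota 0 m.+1)).
have lowP m (s : {fset nat}) : (forall x, x \in s -> (x <= m)%N) -> s \in low m.
  move=> sm; rewrite fpowersetE; apply/fsubsetP => x /sm xm.
  by rewrite seq_fsetE mem_iota.
pose Phi m N :=
  forall s : {fset nat}, s \in low m -> [set` s] `<=` N0 -> Psi s N.
have [m N N' N'N PhiN s sm sN0|m N N1m NN1 Ninf|M [MN1 Minf MPhi]] :=
    @fusion Phi N1 N1inf.
- exact: PsiS N'N (PhiN s sm sN0).
- have [s N' N'' N''N' sN sN0|s N' _ N'N N'inf||N' [? ? N'P]] :=
    @shrink_all _
      (fun (s : {fset nat}) N => [set` s] `<=` N0 -> Psi s N)
      (enum_fset (low m)) N.
  + exact: PsiS N''N' (sN sN0).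
  + have [sN0|nsN0] := pselect ([set` s] `<=` N0); last by exists N'; split.
    have [|N'' [? ? ?]] := Psid s N' sN0 _ N'inf; last by exists N''.
    by apply: subset_trans N1N0; exact: subset_trans NN1.
  + exact: Ninf.
  + by exists N'; split=> // s /N'P.
exists M; split=> //; first exact: subset_trans N1N0.
move=> s sM; have [->|/fset_maxP[m ms smax]] := eqVneq s fset0.
  by apply: PsiS N1E => n [/MN1].
have sN0 : [set` s] `<=` N0.
  by apply: (subset_trans sM); exact: subset_trans N1N0.
have := MPhi m (sM _ ms) s (lowP _ _ smax) sN0.
by apply: PsiS => n [Mn sn]; split=> //; exact: sn.
Qed.

(** * Ultrafilters on the natural numbers *)

Lemma mem_beta_setC (p : beta_omega) (A : set nat) :
  mem_beta p (~` A) <-> ~ mem_beta p A.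
Proof.
split=> [pnA pA|npA]; first by have [x []] := filter_ex (filterI pA pnA).
by have [] := in_ultra_setVsetC A (beta_ultra p).
Qed.

Lemma beta_separate (p q : beta_omega) :
  p <> q -> exists2 A, mem_beta p A & mem_beta q (~` A).
Proof.
move=> pq; apply: contrapT => nA; apply: pq; apply: beta_omega_eqP => A pA.
by apply: contrapT => /mem_beta_setC qA; apply: nA; exists A.
Qed.

Lemma ultra_fmap (T : Type) (h : T -> nat) (F : set_system T) :
  UltraFilter F -> UltraFilter (h @ F).
Proof.
move=> FU; apply: ultra_setVsetC.
move=> A; exact: in_ultra_setVsetC (h @^-1` A) FU.
Qed.

Definition beta_map (h : nat -> nat) (p : beta_omega) : beta_omega :=
  BetaOmega (ultra_fmap h (beta_ultra p)).

Lemma filter_all_seq (T : Type) (F : set_system T) (I : eqType) (r : seq I)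
    (B : I -> set T) :
  Filter F -> (forall i, i \in r -> F (B i)) ->
  F [set x | forall i, i \in r -> B i x].
Proof.
move=> FF; elim: r => [_|i r IH FB]; first by apply: filterS filterT.
have Fi : F (B i) by apply: FB; rewrite inE eqxx.
have Fr : F [set x | forall j, j \in r -> B j x].
  by apply: IH => j jr; apply: FB; rewrite inE jr orbT.
apply: filterS (filterI Fi Fr) => x [xi xr] j.
by rewrite inE => /predU1P[->//|/xr].
Qed.

(** Once the points of Z m contain B m but no earlier B l, label x by the least m
with x in B m: this makes the sets B m disjoint. *)
Lemma labelling (M : set nat) (Z : nat -> set beta_omega) (B : nat -> set nat) :
  (forall m z, M m -> Z m z -> mem_beta z (B m)) ->
  (forall l m z, M l -> M m -> (l < m)%N -> Z m z -> mem_beta z (~` B l)) ->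
  exists b : nat -> nat,
    forall m z, M m -> Z m z -> mem_beta z (b @^-1` [set m]).
Proof.
move=> BZ nBZ.
have minB x : exists b, forall m, M m -> B m x ->
    (forall l, (l < m)%N -> M l -> ~ B l x) -> b = m.
  have [[m0 m0P]|nM] := pselect (exists m, M m /\ B m x); last first.
    by exists 0%N => m Mm Bm; case: nM; exists m.
  have ex : exists m, `[< M m /\ B m x >] by exists m0; exact/asboolP.
  case: (ex_minnP ex) => b /asboolP[Mb Bb] bmin; exists b => m Mm Bm mmin.
  apply/eqP; rewrite eqn_leq bmin ?andTb; last exact/asboolP.
  by rewrite leqNgt; apply/negP => /mmin /(_ Mb).
have [b bP] := choice minB; exists b => m z Mm Zz.
have : mem_beta z [set x | forall l, l \in iota 0 m -> M l -> ~ B l x].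
  apply: (filter_all_seq (B := fun l => [set x | M l -> ~ B l x])) => l.
  rewrite mem_iota add0n => lm; have [Ml|nMl] := pselect (M l).
    by apply: filterS (nBZ _ _ _ Ml Mm lm Zz) => x nBx _.
  by apply: filterS filterT => x _.
move=> /(filterI (BZ _ _ Mm Zz)); apply: filterS => x [Bx lx].
apply: bP => // l lm; apply: lx.
by rewrite mem_iota.
Qed.

Definition injective_on (N : set nat) (g : nat -> beta_omega) :=
  forall i j, N i -> N j -> g i = g j -> i = j.

(** If no value is taken infinitely often, fusion avoids all repetitions. *)
Lemma const_or_inj (g : nat -> beta_omega) (N : set nat) :
  infinite_set N -> exists N', [/\ N' `<=` N, infinite_set N' &
    (exists y, forall n, N' n -> g n = y) \/ injective_on N' g].
Proof.
move=> Ninf.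
have [[y yinf]|nfib] :=
    pselect (exists y, infinite_set (N `&` [set n | g n = y])).
  exists (N `&` [set n | g n = y]); split; [by move=> n []|exact: yinf|].
  by left; exists y => n [].
pose Phi m (N' : set nat) := forall n, N' n -> g n <> g m.
have [m N1 N2 N21 PhiN n /N21/PhiN//|m N1 Nm N1N N1inf|M [MN Minf MPhi]] :=
    @fusion Phi N Ninf.
  exists (N1 `\` (N `&` [set n | g n = g m])); split.
  - by move=> n [].
  - apply: infinite_setD => //; apply: contrapT => fib.
    by apply: nfib; exists (g m).
  - by move=> n [N1n nN] gnm; apply: nN; split=> //; exact: N1N.
exists M; split=> //; right => i j Mi Mj gij.
by have [ij|ji|//] := ltngtP i j; [case: (MPhi i Mi j)|case: (MPhi j Mj i)].
Qed.

(** Of two disjoint infinite halves of a set, an ultrafilter contains at most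
one. *)
Lemma infinite_avoid (Q : seq beta_omega) (M : set nat) :
  infinite_set M -> exists N, [/\ N `<=` M, infinite_set N &
    forall q, q \in Q -> mem_beta q (~` N)].
Proof.
apply: shrink_all => [q N N' N'N|q N _ NM Ninf].
  by apply: filterS => n nN /N'N.
have [e eI eN] := infinite_enum Ninf.
have halfI c : injective (fun n => e (c + n.*2)%N).
  by move=> i j /eI/addnI/double_inj.
have halfinf c := infinite_inj_image (@halfI c) infinite_nat.
have halfN c : range (fun n => e (c + n.*2)%N) `<=` N by move=> _ [n _ <-].
have [q0|/mem_beta_setC q0] :=
  pselect (mem_beta q (range (fun n => e (0 + n.*2)%N))); last first.
  by exists (range (fun n => e (0 + n.*2)%N)).
exists (range (fun n => e (1 + n.*2)%N)); split=> //.
apply: filterS q0 => _ [i _ <-] [j _ /eI].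
by move/(congr1 odd); rewrite !oddD !odd_double.
Qed.

(** * Ramsey's theorem *)

Lemma ksubsetsS (M N : set nat) k : M `<=` N -> ksubsets M k `<=` ksubsets N k.
Proof. by move=> MN s [sM sk]; split=> //; exact: subset_trans MN. Qed.

Lemma ksubsetsU1 (M : set nat) k m (t : {fset nat}) :
  M m -> ksubsets M k t -> m \notin t -> ksubsets M k.+1 (m |` t)%fset.
Proof.
move=> Mm [tM tk] mt; split; last by rewrite cardfsU1 mt tk.
by move=> x /=; rewrite inE => /orP[|/tM//]; rewrite inE => /eqP->.
Qed.

Lemma ksubsets_max (M : set nat) k (s : {fset nat}) : ksubsets M k.+1 s ->
  exists m t, [/\ s = (m |` t)%fset, M m, ksubsets M k t &
    forall x, x \in t -> (x < m)%N].
Proof.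
move=> [sM sk].
have [|m ms mmax] := @fset_maxP s; first by rewrite -cardfs_gt0 sk.
exists m, (s `\ m)%fset; split.
- by rewrite fsetD1K.
- exact: sM.
- split=> [x /=|]; first by rewrite inE => /andP[_ /sM].
  by have := cardfsD1 m s; rewrite ms sk add1n => -[].
- by move=> x; rewrite !inE ltn_neqAle => /andP[-> /mmax].
Qed.

Lemma ksubsets_exists (M : set nat) k : infinite_set M -> exists s, ksubsets M k s.
Proof.
move=> Minf; elim: k => [|k [t [tM tk]]].
  by exists fset0; split=> [x /=|]; rewrite ?inE ?cardfs0.
have [m [Mm mt]] := infinite_setN0 (infinite_setD Minf (finite_fset t)).
by exists (m |` t)%fset; apply: ksubsetsU1 => //; exact/negP.
Qed.

Lemma infinite_beyond (M : set nat) (s : {fset nat}) :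
  infinite_set M -> infinite_set (beyond M s).
Proof.
move=> Minf; have [->|/fset_maxP[m ms mmax]] := eqVneq s fset0.
  by apply: sub_infinite_set Minf => n Mn; split=> // x; rewrite inE.
apply: sub_infinite_set (infinite_setD Minf (finite_II m.+1)) => n /= [Mn].
by move=> /negP; rewrite -leqNgt => mn; split=> // x /mmax /leq_ltn_trans; apply.
Qed.

Lemma beyondS (M N : set nat) s : M `<=` N -> beyond M s `<=` beyond N s.
Proof. by move=> MN n [/MN]. Qed.

(** By fusion the colour of s becomes independent of the largest element of s,
which reduces the size by one. *)
Lemma ramsey k (chi : {fset nat} -> bool) (N : set nat) : infinite_set N ->
  exists (M : set nat) (c : bool), [/\ M `<=` N, infinite_set M &
    forall s, ksubsets M k s -> chi s = c].
Proof.
elim: k chi N => [|k IH] chi N Ninf.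
  exists N, (chi fset0); split=> // s [_ /eqP].
  by rewrite cardfs_eq0 => /eqP ->.
pose Psi (s : {fset nat}) (N' : set nat) :=
  exists c, forall n, N' n -> chi (n |` s)%fset = c.
have [s N1 N2 N21 [c cN]|s N' _ N'N N'inf|M [MN Minf MPsi]] :=
    @fusion_fset Psi N Ninf.
- by exists c => n /N21/cN.
- have [Tinf|Tfin] := pselect (infinite_set (N' `&` [set n | chi (n |` s)%fset])).
    exists (N' `&` [set n | chi (n |` s)%fset]); split=> //.
    by exists true => n [].
  exists (N' `\` [set n | chi (n |` s)%fset]); split=> //.
    move=> fin; apply: N'inf.
    rewrite -(setUIDK N' [set n | chi (n |` s)%fset]) finite_setU.
    by split=> //; exact: contrapT Tfin.
  by exists false => n [_ /negP/negbTE].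
have cP (s : {fset nat}) : exists c, [set` s] `<=` M ->
    forall n, beyond M s n -> chi (n |` s)%fset = c.
  have [/MPsi[c ?]|nsM] := pselect ([set` s] `<=` M); last by exists true.
  by exists c.
have [c cE] := choice cP.
have [M' [d [M'M M'inf cd]]] := IH c M Minf.
exists M', d; split=> //; first exact: subset_trans MN.
move=> _ /ksubsets_max[m [t [-> M'm tM' tm]]].
rewrite (cE t) ?cd //; first by apply: subset_trans M'M; case: tM'.
by split=> //; exact: M'M.
Qed.

(** * Functions that are constant or labelled *)

(** An ultrafilter containing the finite set s is principal at an element of s;
thus b pushes f s forward to an element of s, which need not be named. *)
Definition labelled (M : set nat) (k : nat) (f : {fset nat} -> beta_omega) :=
  exists b : nat -> nat,
    forall s, ksubsets M k s -> mem_beta (f s) (b @^-1` [set` s]).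

(** The images of the points of Z under b are finitely many ultrafilters, and M
has an infinite subset N in none of them; since b pushes the values of f on
[N]^k into N, the set of x with b x outside N separates Z from these values. *)
Lemma labelled_avoid (M : set nat) k (f : {fset nat} -> beta_omega)
    (Z : seq beta_omega) :
  infinite_set M -> labelled M k f ->
  exists N B, [/\ N `<=` M, infinite_set N,
    forall z, z \in Z -> mem_beta z B &
    forall s, ksubsets N k s -> mem_beta (f s) (~` B)].
Proof.
move=> Minf [b bP].
have [N [NM Ninf NZ]] := infinite_avoid (map (beta_map b) Z) Minf.
exists N, (b @^-1` (~` N)); split=> // [z zZ|s sN].
  by apply: (NZ (beta_map b z)); apply/mapP; exists z.
apply: filterS (bP s (ksubsetsS NM sN)) => x /= xs; apply.
by case: sN => + _; apply.
Qed.

(** Here f has arity k.+1, and n is the largest element of its argument. *)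
Definition last_inj (N : set nat) k (f : {fset nat} -> beta_omega) :=
  forall t, ksubsets N k t -> injective_on (beyond N t) (fun n => f (n |` t)%fset).

Lemma last_injS (M N : set nat) k f : M `<=` N -> last_inj N k f -> last_inj M k f.
Proof.
move=> MN fN t tM i j iM jM; apply: fN; first exact: ksubsetsS tM.
- exact: beyondS iM.
- exact: beyondS jM.
Qed.

(** Beta omega has no nontrivial convergent sequences, in several variables.  If
some z cannot be separated from the values of f on any infinite subset of N',
then, by Ramsey's theorem, f converges to z in the sense that each neighbourhood
of z contains all values of f on a suitable subset of any given infinite subset
of N'.  Every point other than z can then be separated, and injectivity allows
the value z itself to be omitted. *)
Lemma last_inj_avoid (N : set nat) k f : infinite_set N -> last_inj N k f ->
  exists N1, [/\ N1 `<=` N, infinite_set N1 &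
    forall s (N' : set nat),
      ksubsets N1 k.+1 s -> N' `<=` N1 -> infinite_set N' ->
    exists N'' B, [/\ N'' `<=` N', infinite_set N'', mem_beta (f s) B &
      forall t, ksubsets N'' k.+1 t -> mem_beta (f t) (~` B)]].
Proof.
move=> Ninf finj.
pose unavoidable z (N' : set nat) := forall B (N'' : set nat),
  mem_beta z B -> N'' `<=` N' -> infinite_set N'' ->
  ~ forall t, ksubsets N'' k.+1 t -> mem_beta (f t) (~` B).
have [[z [N' [N'N N'inf zN']]]|nun] :=
    pselect (exists z N', [/\ N' `<=` N, infinite_set N' & unavoidable z N']).
- have [N1 [c [N1N' N1inf cE]]] :=
    @ramsey k.+1 (fun s => `[< f s = z >]) N' N'inf.
  have {cE} fz s : ksubsets N1 k.+1 s -> f s <> z.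
    move=> N1s; case: c cE => cE; last by move/asboolP; rewrite cE.
    have {}cE t : ksubsets N1 k.+1 t -> f t = z by move=> /cE/asboolP.
    (* f = z on all of [N1]^(k+1) would contradict injectivity at i and j. *)
    have [t tN1] := ksubsets_exists k N1inf.
    have binf := @infinite_beyond N1 t N1inf.
    have [i ti] := infinite_setN0 binf.
    have [j [tj ij]] := infinite_setN0 (infinite_setD binf (finite_set1 i)).
    have fU n : beyond N1 t n -> f (n |` t)%fset = z.
      move=> [N1n tn]; apply/cE/ksubsetsU1 => //.
      by apply/negP => /tn; rewrite ltnn.
    exfalso; apply: ij; apply: (@last_injS _ _ k f _ finj t tN1) => //=.
      exact: subset_trans N'N.
    by rewrite !fU.
  exists N1; split=> //; first exact: subset_trans N'N.
  move=> s N2 sN1 N2N1 N2inf.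
  have [B fsB zB] := beta_separate (fz s sN1).
  have [N3 [d [N3N2 N3inf dE]]] :=
    @ramsey k.+1 (fun t => `[< mem_beta (f t) (~` B) >]) N2 N2inf.
  exists N3, B; split=> // t tN3; case: d dE => dE; first exact/asboolP/dE.
  have N3N' : N3 `<=` N' by apply: subset_trans N1N'; exact: subset_trans N2N1.
  case: (zN' (~` B) N3 zB N3N' N3inf).
  by move=> t' /dE /asboolP; rewrite -mem_beta_setC.
- exists N; split=> // s N' sN N'N N'inf; apply: contrapT => nB.
  apply: nun; exists (f s), N'; split=> // B N'' fsB N''N' N''inf tB.
  by apply: nB; exists N'', B.
Qed.

Lemma fsets_upto m : exists r : seq {fset nat},
  forall s : {fset nat}, (forall x, x \in s -> (x <= m)%N) <-> s \in r.
Proof.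
exists (enum_fset (fpowerset (seq_fset tt (iota 0 m.+1)))) => s.
rewrite -[X in _ <-> is_true X]/(s \in fpowerset _) fpowersetE; split.
  by move=> sm; apply/fsubsetP => x /sm xm; rewrite seq_fsetE mem_iota.
by move=> /fsubsetP sm x /sm; rewrite seq_fsetE mem_iota.
Qed.

(** Here f has arity k.+1, so that t1 completes t0 to an argument of f. *)
Definition avoids k (f : {fset nat} -> beta_omega) (Z : seq beta_omega)
    (t0 : {fset nat}) (N : set nat) :=
  exists B, (forall z, z \in Z -> mem_beta z B) /\
    forall t1, ksubsets N (k.+1 - #|` t0|) t1 ->
      mem_beta (f (t0 `|` t1)%fset) (~` B).

Lemma avoidsS k f Z t0 (N N' : set nat) :
  N' `<=` N -> avoids k f Z t0 N -> avoids k f Z t0 N'.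
Proof.
by move=> N'N [B [ZB fB]]; exists B; split=> // t1 /(ksubsetsS N'N); exact: fB.
Qed.

Lemma avoids_fset0 (N1 : set nat) k f (Z : seq beta_omega) (N : set nat) :
  (forall s (N' : set nat),
    ksubsets N1 k.+1 s -> N' `<=` N1 -> infinite_set N' ->
    exists N'' B, [/\ N'' `<=` N', infinite_set N'', mem_beta (f s) B &
      forall t, ksubsets N'' k.+1 t -> mem_beta (f t) (~` B)]) ->
  (forall z, z \in Z -> exists2 s, ksubsets N1 k.+1 s & f s = z) ->
  N `<=` N1 -> infinite_set N ->
  exists N', [/\ N' `<=` N, infinite_set N' & avoids k f Z fset0 N'].
Proof.
move=> av ZN1 NN1 Ninf.
pose Psi z (N' : set nat) := exists B, mem_beta z B /\
  forall t, ksubsets N' k.+1 t -> mem_beta (f t) (~` B).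
have [z N2 N3 N32 [B [zB fB]]|z N2 zZ N2N N2inf||N' [N'N N'inf N'B]] :=
    @shrink_all _ Psi Z N.
- by exists B; split=> // t /(ksubsetsS N32)/fB.
- have [s sN1 <-] := ZN1 z zZ.
  have [|N3 [B [? ? ? ?]]] := av s N2 sN1 _ N2inf; first exact: subset_trans NN1.
  by exists N3; split=> //; exists B.
- exact: Ninf.
exists N'; split=> //.
have BP z : exists B, z \in Z -> mem_beta z B /\
    forall t, ksubsets N' k.+1 t -> mem_beta (f t) (~` B).
  by have [/N'B[B]|nz] := boolP (z \in Z); [exists B|exists setT].
have [B BE] := choice BP.
exists (~` [set x | forall z, z \in Z -> (~` B z) x]); split=> [z zZ|t].
  by apply: filterS (BE z zZ).1 => x Bzx nBx; exact: nBx z zZ Bzx.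
rewrite cardfs0 subn0 fset0U setCK => tN'.
by apply: filter_all_seq => z zZ; exact: (BE z zZ).2.
Qed.

(** By fusion, with the requirement on m that some B contains f s for all s with
maximum m and misses f s for all s with a part t0 in {0, ..., m} and a nonempty
part t1 beyond.  For fixed t0, the values f (t0 `|` t1) are those of a function
of t1 that is injective in its last element: if t0 is nonempty this function has
smaller arity, so it is labelled by induction and labelled_avoid applies; if t0
is empty it is f, and last_inj_avoid applies. *)
Lemma last_inj_labelled k f (N : set nat) : infinite_set N -> last_inj N k f ->
  exists M, [/\ M `<=` N, infinite_set M & labelled M k.+1 f].
Proof.
elim/ltn_ind: k f N => k IH f N Ninf finj.
have [N1 [N1N N1inf av]] := last_inj_avoid Ninf finj.
have {}finj := last_injS N1N finj.
pose Phi m (N' : set nat) := exists B,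
  (forall t : {fset nat}, ksubsets N1 k t -> (forall x, x \in t -> (x < m)%N) ->
    mem_beta (f (m |` t)%fset) B) /\
  (forall t0 t1 : {fset nat},
    [set` t0] `<=` N1 -> (forall x, x \in t0 -> (x <= m)%N) ->
    (#|` t0| <= k)%N -> ksubsets N' (k.+1 - #|` t0|) t1 ->
    mem_beta (f (t0 `|` t1)%fset) (~` B)).
have [m N2 N3 N32 [B [mB tB]]|m N2 N1m N2N1 N2inf|M [MN1 Minf MPhi]] :=
    @fusion Phi N1 N1inf.
- by exists B; split=> // t0 t1 t0N1 t0m t0k /(ksubsetsS N32); exact: tB.
- have [r rP] := fsets_upto m.
  pose Z := [seq f (m |` t)%fset | t : {fset nat} <- r &
    `[< ksubsets N1 k t /\ forall x, x \in t -> (x < m)%N >]].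
  have ZN1 z : z \in Z -> exists2 s, ksubsets N1 k.+1 s & f s = z.
    move=> /mapP[t]; rewrite mem_filter => /andP[/asboolP[tN1 tm] _] ->.
    exists (m |` t)%fset => //; apply: ksubsetsU1 => //.
    by apply/negP => /tm; rewrite ltnn.
  pose N2' := N2 `\` `I_m.+1.
  have N2'N1 : N2' `<=` N1 by move=> n [/N2N1].
  pose Psi (t0 : {fset nat}) (N' : set nat) :=
    [set` t0] `<=` N1 -> (#|` t0| <= k)%N -> avoids k f Z t0 N'.
  have [t0 N3 N4 N43 avN3 t0N1 t0k|t0 N3 t0r N3N2 N3inf||N' [N'N2 N'inf N'B]] :=
      @shrink_all _ Psi r N2'.
  + exact: avoidsS N43 (avN3 t0N1 t0k).
  + have N3N1 : N3 `<=` N1 by exact: subset_trans N2'N1.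
    have [[t0N1 t0k]|nt0] :=
      pselect ([set` t0] `<=` N1 /\ (#|` t0| <= k)%N); last first.
      by exists N3; split=> // t0N1 t0k; case: nt0.
    have [->|t0n0] := eqVneq t0 fset0.
      have [N4 [? ? ?]] := avoids_fset0 av ZN1 N3N1 N3inf.
      by exists N4; split.
    rewrite -cardfs_gt0 in t0n0.
    have [||N4 [N4N3 N4inf N4lab]] :=
        IH (k - #|` t0|)%N _ (fun t => f (t0 `|` t)%fset) N3 N3inf.
    * by rewrite ltn_subrL t0n0 (leq_trans t0n0).
    * move=> t tN3 i j [N3i ti] [N3j tj] fij.
      have t0lt x n : N3 n -> x \in t0 -> (x < n)%N.
        move=> /N3N2[_ /negP]; rewrite -leqNgt => mn /((rP t0).2 t0r).
        by move=> /leq_ltn_trans; apply.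
      apply: (finj (t0 `|` t)%fset).
      - split=> [x /=|].
          by rewrite inE => /orP[/t0N1//|]; case: tN3 => + _ => /[apply] /N3N1.
        rewrite cardfsU (_ : t0 `&` t = fset0)%fset ?cardfs0 ?subn0.
          by rewrite (proj2 tN3) subnKC.
        apply/fsetP => x; rewrite !inE; apply/negP => /andP[xt0 xt].
        have /t0lt/(_ xt0) : N3 x by case: tN3 => + _; apply.
        by rewrite ltnn.
      - split; first exact: N3N1.
        by move=> x; rewrite inE => /orP[/t0lt|/ti//]; apply.
      - split; first exact: N3N1.
        by move=> x; rewrite inE => /orP[/t0lt|/tj//]; apply.
      - by rewrite /= ![(_ |` (t0 `|` t))%fset]fsetUCA.
    have [N5 [B [N5N4 N5inf ZB N5B]]] := labelled_avoid Z N4inf N4lab.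
    exists N5; split=> //; first exact: subset_trans N4N3.
    by move=> _ _; exists B; split=> // t1; rewrite subSn // => /N5B.
  + exact: infinite_setD N2inf (finite_II _).
  have BP (t0 : {fset nat}) : exists B,
      t0 \in r -> [set` t0] `<=` N1 -> (#|` t0| <= k)%N ->
      (forall z, z \in Z -> mem_beta z B) /\
      forall t1, ksubsets N' (k.+1 - #|` t0|) t1 ->
        mem_beta (f (t0 `|` t1)%fset) (~` B).
    have [[t0r [t0N1 t0k]]|nt0] :=
      pselect (t0 \in r /\ [set` t0] `<=` N1 /\ (#|` t0| <= k)%N).
      by have [B] := N'B t0 t0r t0N1 t0k; exists B.
    by exists setT => ? ? ?; case: nt0.
  have [B BE] := choice BP.
  exists N'; split=> //; first by move=> n /N'N2[].
  exists [set x | forall t0 : {fset nat}, t0 \in r -> [set` t0] `<=` N1 ->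
    (#|` t0| <= k)%N -> B t0 x]; split=> [t tN1 tm|t0 t1 t0N1 t0m t0k t1N'].
    apply: (filter_all_seq (B := fun t0 : {fset nat} =>
      [set x | [set` t0] `<=` N1 -> (#|` t0| <= k)%N -> B t0 x])) => t0 t0r.
    have [[t0N1 t0k]|nt0] :=
      pselect ([set` t0] `<=` N1 /\ (#|` t0| <= k)%N); last first.
      by apply: filterS filterT => x _ ? ?; case: nt0.
    suff : mem_beta (f (m |` t)%fset) (B t0) by apply: filterS => x Bx _ _.
    apply: (BE t0 t0r t0N1 t0k).1; apply/mapP; exists t => //.
    rewrite mem_filter; apply/andP; split.
      exact/asboolP.
    by apply/rP => x /tm /ltnW.
  have t0r : t0 \in r by apply/rP.
  apply: filterS ((BE t0 t0r t0N1 t0k).2 t1 t1N') => x nB Bx.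
  by apply: nB; exact: Bx.
exists M; split=> //; first exact: subset_trans N1N.
have BP m : exists B, M m ->
    (forall t : {fset nat}, ksubsets N1 k t -> (forall x, x \in t -> (x < m)%N) ->
      mem_beta (f (m |` t)%fset) B) /\
    (forall t0 t1 : {fset nat},
      [set` t0] `<=` N1 -> (forall x, x \in t0 -> (x <= m)%N) ->
      (#|` t0| <= k)%N ->
      ksubsets [set n | M n /\ (m < n)%N] (k.+1 - #|` t0|) t1 ->
      mem_beta (f (t0 `|` t1)%fset) (~` B)).
  by have [/MPhi[B]|nMm] := pselect (M m); [exists B|exists setT].
have [B BE] := choice BP.
pose Z m := [set z | exists t, [/\ ksubsets M k t,
  forall x, x \in t -> (x < m)%N & z = f (m |` t)%fset]].
have [m z Mm [t [tM tm ->]]|l m z Ml Mm lm [t [tM tm ->]]|b bP] := @labelling M Z B.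
- apply: (BE m Mm).1 => //; exact: ksubsetsS tM.
(* The part of s up to l is t0; the rest contains m and lies beyond l. *)
- pose s := (m |` t)%fset.
  have sM : ksubsets M k.+1 s.
    by apply: ksubsetsU1 => //; apply/negP => /tm; rewrite ltnn.
  pose t0 := [fset x in s | (x <= l)%N]%fset.
  have t0s : (t0 `<=` s)%fset by apply/fsubsetP => x; rewrite !inE => /andP[].
  have -> : (m |` t)%fset = (t0 `|` (s `\` t0))%fset.
    apply/fsetP => x; rewrite !inE.
    by case: (x == m); case: (x \in t); case: (x <= l)%N.
  have t0M : [set` t0] `<=` M.
    by move=> x /= /(fsubsetP t0s); case: sM => + _; apply.
  apply: (BE l Ml).2.
  + exact: subset_trans MN1.
  + by move=> x; rewrite !inE => /andP[].
  + case: tM => _ <-; apply: fsubset_leq_card; apply/fsubsetP => x.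
    rewrite !inE => /andP[/orP[/eqP->|//]].
    by rewrite leqNgt lm.
  + split.
      move=> x /=; rewrite in_fsetD => /andP[xt0 xs]; split.
        by case: sM => + _; apply.
      by move: xt0; rewrite in_fset /= inE /= xs /= ltnNge.
    by rewrite cardfsDS // (proj2 sM).
exists b => s /ksubsets_max[m [t [-> Mm tM tm]]].
have : mem_beta (f (m |` t)%fset) (b @^-1` [set m]) by apply: bP => //; exists t.
by apply: filterS => x /= ->; rewrite !inE eqxx.
Qed.

(** The dichotomy on which everything rests. If f is a function h of s without
its largest element, a labelling of h is one of f, for it yields an element of a
subset of s. *)
Lemma constant_or_labelled k f (N : set nat) : infinite_set N ->
  exists M, [/\ M `<=` N, infinite_set M &
    (exists y, forall s, ksubsets M k s -> f s = y) \/ labelled M k f].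
Proof.
elim: k f N => [|k IH] f N Ninf.
  exists N; split=> //; left; exists (f fset0) => s [_ /eqP].
  by rewrite cardfs_eq0 => /eqP ->.
pose Psi (s : {fset nat}) (N' : set nat) :=
  (exists y, forall n, N' n -> f (n |` s)%fset = y) \/
  injective_on N' (fun n => f (n |` s)%fset).
have [s N1 N2 N21 [[y fy]|finj]|s N1 _ _ N1inf|M1 [M1N M1inf M1P]] :=
    @fusion_fset Psi N Ninf.
- by left; exists y => n /N21/fy.
- by right=> i j /N21 N1i /N21 N1j; exact: finj.
- by have [N2 [? ? ?]] := const_or_inj (fun n => f (n |` s)%fset) N1inf; exists N2.
pose isc s := `[< exists y, forall n, beyond M1 s n -> f (n |` s)%fset = y >].
have [M2 [c [M2M1 M2inf cE]]] := @ramsey k isc M1 M1inf.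
have M2N : M2 `<=` N by exact: subset_trans M1N.
case: c cE => cE.
- have hP s : exists y,
      ksubsets M2 k s -> forall n, beyond M1 s n -> f (n |` s)%fset = y.
    have [/cE/asboolP[y ?]|ns] := pselect (ksubsets M2 k s); first by exists y.
    by exists (f s).
  have [h hE] := choice hP.
  have [M3 [M3M2 M3inf M3P]] := IH h M2 M2inf.
  have fh m t : M3 m -> ksubsets M3 k t -> (forall x, x \in t -> (x < m)%N) ->
      f (m |` t)%fset = h t.
    move=> M3m tM3 tm; apply: hE; first exact: ksubsetsS tM3.
    by split=> //; exact/M2M1/M3M2.
  exists M3; split=> //; first exact: subset_trans M2N.
  case: M3P => [[y hy]|[b hb]]; [left; exists y|right; exists b].
    by move=> _ /ksubsets_max[m [t [-> M3m tM3 tm]]]; rewrite fh // hy.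
  move=> _ /ksubsets_max[m [t [-> M3m tM3 tm]]]; rewrite fh //.
  by apply: filterS (hb t tM3) => x /= xt; rewrite inE xt orbT.
- have [|M3 [M3M2 M3inf M3P]] := @last_inj_labelled k f M2 M2inf.
    move=> t tM2 i j iM2 jM2.
    have tM1 : [set` t] `<=` M1 by apply: subset_trans M2M1; case: tM2.
    have [cst|finj] := M1P t tM1; last by apply: finj; exact: beyondS M2M1 _ _.
    by have := cE t tM2; rewrite /isc asboolT.
  exists M3; split=> //; first exact: subset_trans M2N.
  by right.
Qed.

(** * Limits along the powers of an ultrafilter *)

Lemma ultra_lim_subproof (p : beta_omega) (F : nat -> beta_omega) :
  UltraFilter [set B | mem_beta p [set m | mem_beta (F m) B]].
Proof.
have lim_proper : ProperFilter [set B | mem_beta p [set m | mem_beta (F m) B]].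
  apply: Build_ProperFilter_ex.
    move=> A pA; have [m mA] := filter_ex (F := mem_beta p) pA.
    exact: filter_ex mA.
  split.
  - apply: (@filterS _ (mem_beta p)) filterT => m _.
    exact: (@filterT _ (mem_beta (F m))).
  - move=> A B pA pB.
    apply: (@filterS _ (mem_beta p)) (@filterI _ (mem_beta p) _ _ _ pA pB).
    move=> m [].
    exact: (@filterI _ (mem_beta (F m))).
  - move=> A B AB; apply: (@filterS _ (mem_beta p)) => m.
    exact: (@filterS _ (mem_beta (F m))).
apply: ultra_setVsetC => A.
have [pA|/mem_beta_setC pnA] := pselect (mem_beta p [set m | mem_beta (F m) A]).
  by left.
by right; apply: filterS pnA => m; rewrite /= mem_beta_setC.
Qed.

Definition ultra_lim (p : beta_omega) (F : nat -> beta_omega) : beta_omega :=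
  BetaOmega (ultra_lim_subproof p F).

(** By power_limE this is the limit of f along power_filter p M k for any M in
p; in the iterated form it is visibly an ultrafilter. *)
Fixpoint power_lim (p : beta_omega) k (f : {fset nat} -> beta_omega) :
    beta_omega :=
  if k is k'.+1 then
    ultra_lim p (fun m => power_lim p k' (fun s => f (m |` s)%fset))
  else f fset0.

Lemma free_cofinite (p : beta_omega) (F : set nat) :
  free_ultrafilter (mem_beta p) -> finite_set F -> mem_beta p (~` F).
Proof.
move=> [_ pfree] Ffin.
have pn n : mem_beta p (~` [set n]).
  apply/mem_beta_setC => pn.
  have : (\bigcap_(A in mem_beta p) A) n.
    by move=> A pA; have [m [Am /= <-]] := filter_ex (filterI pA pn).
  by rewrite pfree.
have : mem_beta p [set x |
    forall n, n \in enum_fset (fset_set F) -> (~` [set n]) x].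
  by apply: filter_all_seq => n _; exact: pn.
apply: filterS => x xF Fx; apply: (xF x) => //.
by rewrite -[X in is_true X]/(x \in fset_set F) in_fset_set // inE.
Qed.

Lemma free_tail (p : beta_omega) (M : set nat) m :
  free_ultrafilter (mem_beta p) -> mem_beta p M -> mem_beta p (M `\` `I_m.+1).
Proof. by move=> pf pM; apply: filterI => //; exact/free_cofinite/finite_II. Qed.

Lemma notin_tail (M : set nat) k m s : ksubsets (M `\` `I_m.+1) k s -> m \notin s.
Proof. by move=> [sM _]; apply/negP => /sM[_] /=; rewrite ltnSn. Qed.

Lemma power_lim_mem (p : beta_omega) (M C : set nat) k f :
  free_ultrafilter (mem_beta p) -> mem_beta p M ->
  (forall s, ksubsets M k s -> mem_beta (f s) C) -> mem_beta (power_lim p k f) C.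
Proof.
move=> pf; elim: k M f => [|k IH] M f pM fC /=.
  by apply: fC; split=> [x /=|]; rewrite ?inE ?cardfs0.
apply: filterS (pM) => m Mm; apply: (IH (M `\` `I_m.+1)); first exact: free_tail.
move=> s sM; apply: fC; apply: ksubsetsU1 (notin_tail sM) => //.
by apply: ksubsetsS sM => n [].
Qed.

Lemma power_limE (p : beta_omega) (M B : set nat) k f :
  free_ultrafilter (mem_beta p) -> mem_beta p M ->
  mem_beta (power_lim p k f) B <->
  power_filter (mem_beta p) M k [set s | ksubsets M k s /\ mem_beta (f s) B].
Proof.
move=> pf; elim: k M f => [|k IH] M f pM /=.
  split=> [fB|/seteqP[_]]; last by move=> /(_ fset0 erefl)[].
  apply/seteqP; split=> [s [[_ /eqP]]|_ ->]; first by rewrite cardfs_eq0 => /eqP ->.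
  by split=> //; split=> [x /=|]; rewrite ?inE ?cardfs0.
have tailE m : M m -> [set s | ksubsets (M `\` `I_m.+1) k s /\
    (ksubsets M k.+1 (m |` s)%fset /\ mem_beta (f (m |` s)%fset) B)] =
    [set s | ksubsets (M `\` `I_m.+1) k s /\ mem_beta (f (m |` s)%fset) B].
  move=> Mm; apply/seteqP; split=> s [sM]; first by case.
  move=> fB; split=> //; split=> //; apply: ksubsetsU1 (notin_tail sM) => //.
  by apply: ksubsetsS sM => n [].
split=> [limB|[_]].
  split=> [s [] //|]; apply: filterS (filterI pM limB) => m [Mm mB].
  split=> //; rewrite tailE //; apply/IH => //; exact: free_tail.
apply: filterS => m [Mm]; rewrite tailE // => mB.
by apply/(IH (M `\` `I_m.+1)) => //; exact: free_tail.
Qed.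

Lemma beta_map_power_lim h p k f :
  beta_map h (power_lim p k f) = power_lim p k (beta_map h \o f).
Proof.
apply: beta_omega_eqP => A.
rewrite -[mem_beta (beta_map _ _) A]/(mem_beta (power_lim p k f) (h @^-1` A)).
elim: k f => // k IH f; apply: (@filterS _ (mem_beta p)) => m; exact: IH.
Qed.

(** The labelling b recovers p from the limit: if X is in p then b maps f s into
X for all s in [X]^k. *)
Lemma labelled_power_lim p q k (M : set nat) f : 
  free_ultrafilter (mem_beta p) -> free_ultrafilter (mem_beta q) ->
  mem_beta p M -> mem_beta q M -> labelled M k f ->
  power_lim p k f = power_lim q k f -> p = q.
Proof.
move=> pf qf pM qM [b bP] pq.
have bmap r : free_ultrafilter (mem_beta r) -> mem_beta r M ->
    r = beta_map b (power_lim r k f).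
  move=> rf rM; apply: beta_omega_eqP => X rX.
  apply: (@power_lim_mem _ (M `&` X)) => //; first exact: filterI.
  move=> s sMX; have sM : ksubsets M k s by apply: ksubsetsS sMX => n [].
  by apply: filterS (bP s sM) => x /=; case: sMX => + _ => /[apply] -[].
by rewrite (bmap p) // (bmap q) // pq.
Qed.

(** * A Bernstein-type choice of power limits *)

(** The independent family of Hausdorff: on the countable set of triples
(F, A, r), F a finite set of naturals, A a finite family of such sets and r a
natural number, the sets C X of triples with X `&` F in A are independent, X
ranging over all sets of naturals.  For each T there is an ultrafilter
containing C X exactly for X in T, obtained from triples given by larger and
larger finite sets S of values of X, where F tells the members of S apart and A
consists of the traces on F of the members of S in T.  The component r tends to
infinity and makes the ultrafilter free. *)
Lemma independent_points (M : set nat) : infinite_set M ->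
  exists u : set (set nat) -> beta_omega, [/\ injective u,
    forall T, free_ultrafilter (mem_beta (u T)) &
    forall T, mem_beta (u T) M].
Proof.
move=> /infinite_enum[e eI eM].
have [d dP] : exists d : set nat -> set nat -> nat,
    forall X Y, (X (d X Y) <-> Y (d X Y)) -> X = Y.
  have dXY X Y : exists n : nat, (X n <-> Y n) -> X = Y.
    apply: contrapT => nd; apply: (nd); exists 0%N => _; apply/seteqP.
    by split=> n XYn; apply: contrapT => nXYn; apply: nd; exists n => -[]; tauto.
  have [d dE] := choice (fun XY : set nat * set nat => dXY XY.1 XY.2).
  by exists (fun X Y => d (X, Y)) => X Y; exact: dE (X, Y).
pose Fs (S : {fset set nat}) : {fset nat} := [fset d X Y | X in S, Y in S]%fset.
pose tr (F : {fset nat}) (X : set nat) : {fset nat} :=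
  [fset x in F | `[< X x >]]%fset.
pose D : countType := ({fset nat} * {fset {fset nat}} * nat)%type.
pose pt (T : set (set nat)) (j : {fset set nat} * nat) : nat :=
  e (@choice.pickle D (Fs j.1,
  [fset tr (Fs j.1) X | X in [fset X in j.1 | `[< T X >]]]%fset, j.2)).
pose base := filter_from setT (fun i : {fset set nat} * nat =>
  [set j : {fset set nat} * nat | (i.1 `<=` j.1)%fset /\ (i.2 <= j.2)%N]).
have baseP : ProperFilter base.
  apply: filter_from_proper; last by move=> i _; exists i.
  apply: filter_fromT_filter; first by exists (fset0, 0%N).
  move=> i j; exists ((i.1 `|` j.1)%fset, maxn i.2 j.2) => l /= [].
  by rewrite fsubUset geq_max => /andP[? ?] /andP[? ?].
have uP T : exists u : beta_omega, fmap (pt T) base `<=` mem_beta u.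
  have [G [GU Gb]] := @ultraFilterLemma _ (fmap (pt T) base) _.
  by exists (BetaOmega GU).
have [u uE] := choice uP.
have uM T : mem_beta (u T) M.
  by apply: uE; apply: (@filterS _ base _ setT); [move=> j _; exact: eM|exact: filterT].
pose C (X : set nat) := [set n | exists F (A : {fset {fset nat}}) (r : nat),
  n = e (@choice.pickle D (F, A, r)) /\ tr F X \in A].
have uC T X : T X -> mem_beta (u T) (C X).
  move=> TX; apply: uE; exists ([fset X]%fset, 0%N) => // j [/= Xj _].
  exists (Fs j.1), [fset tr (Fs j.1) X | X in
    [fset X in j.1 | `[< T X >]]]%fset, j.2.
  split=> //; apply: in_imfset => /=; rewrite !inE asboolT // andbT.
  by rewrite fsub1set in Xj.
have unC T X : ~ T X -> mem_beta (u T) (~` C X).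
  move=> nTX; apply: uE; exists ([fset X]%fset, 0%N) => // j [/= Xj _].
  rewrite fsub1set in Xj.
  move=> [F [A [r [/eI/(pcan_inj choice.pickleK) []]]]] <- <- _.
  move=> /imfsetP[Y /=]; rewrite !inE => /andP[Yj /asboolP TY] XY; apply: nTX.
  suff -> : X = Y by [].
  apply: dP; move/fsetP/(_ (d X Y)): XY; rewrite !inE.
  have -> : d X Y \in Fs j.1 by apply/imfset2P; exists X => //; exists Y.
  by rewrite /=; split=> [/asboolT|/asboolT];
     [rewrite XY|rewrite -XY] => /asboolP.
exists u; split=> // [T T' TT'|T].
  apply/seteqP; split=> X TX; apply: contrapT => /unC/mem_beta_setC; apply.
    by rewrite -TT'; exact: uC.
  by rewrite TT'; exact: uC.
split; first exact: beta_ultra.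
apply/seteqP; split=> // x /(_ (~` [set x])) ux; apply: (ux _ erefl).
apply: uE; have [[j0 j0x]|nj] := pselect (exists j, pt T j = x).
  exists (fset0, j0.2.+1) => // j [_ /= j0j] jx; move: j0j.
  move: jx; rewrite -j0x => /eI/(pcan_inj choice.pickleK)[_ _ ->].
  by rewrite ltnn.
by exists (fset0, 0%N) => // j _ jx; apply: nj; exists j.
Qed.

Definition embeds_below (I : Type) (R : I -> I -> Prop) (i : I) :=
  exists2 h : I -> I, injective h & forall j, R (h j) i.

(** Well-order I by its cardinal: if some well-order has an initial segment
into which I embeds, transport the order of the least such segment to I. *)
Lemma initial_well_order (I : Type) : exists R : I -> I -> Prop,
  [/\ well_founded R, forall i j, i <> j -> R i j \/ R j i &
      forall i, ~ embeds_below R i].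
Proof.
have [R Rwo] := wochoice.well_ordering_principle {classic I}.
pose lt (x y : I) := R x y /\ x <> y.
have Rmin (A : set I) : A !=set0 -> exists2 z, A z & forall x, A x -> R z x.
  move=> [x0 Ax0].
  have [|z [[/asboolP Az zmin] _]] := Rwo [pred x : {classic I} | `[< A x >]].
    by exists x0; exact/asboolP.
  by exists z => // x Ax; apply: zmin; exact/asboolP.
have Rtot x y : R x y \/ R y x.
  have [|z [->|->] zmin] := Rmin [set x; y]; first by exists x; left.
    by left; apply: zmin; right.
  by right; apply: zmin; left.
have Rxx x : R x x by have [] := Rtot x x.
have Ranti x y : R x y -> R y x -> x = y.
  move=> xy yx.
  pose A : {pred {classic I}} := [pred z : {classic I} | `[< z = x \/ z = y >]].
  have [|z [_ zuniq]] := Rwo A; first by exists x; apply/asboolP; left.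
  rewrite -(zuniq x) ?(zuniq y) //; split.
  - by apply/asboolP; right.
  - by move=> t /asboolP[->|->].
  - by apply/asboolP; left.
  - by move=> t /asboolP[->|->].
have lt_wf : well_founded lt.
  move=> x; apply: contrapT => nx.
  have [|z nz zmin] := Rmin [set y | ~ Acc lt y]; first by exists x.
  apply: nz; constructor => y [yz yNz]; apply: contrapT => ny.
  by apply: yNz; apply: Ranti => //; exact: zmin.
have lt_tot x y : x <> y -> lt x y \/ lt y x.
  by move=> xy; have [] := Rtot x y; [left|right]; split=> // yx; exact: xy.
have [[i iP]|nbelow] := pselect (exists i, embeds_below lt i); last first.
  by exists lt; split=> // i iP; apply: nbelow; exists i.
have [m [h hI hm] mmin] : exists2 m, embeds_below lt m &
    forall j, lt j m -> ~ embeds_below lt j.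
  have [|m mP mmin] := Rmin (embeds_below lt); first by exists i.
  by exists m => // j [jm jNm] /mmin mj; apply: jNm; exact: Ranti.
exists (fun x y => lt (h x) (h y)); split.
- exact: Inverse_Image.wf_inverse_image.
- by move=> x y xy; apply: lt_tot => /hI.
- move=> x [g gI gx]; apply: (mmin (h x)); first exact: hm.
  by exists (h \o g); [exact: inj_comp|].
Qed.

(** Choose the x i by transfinite recursion along an order as in
initial_well_order: if all of L i were already used, I would embed below i. *)
Lemma distinct_representatives (I : Type) (Y : choiceType) (L : I -> set Y) (y0 : Y) :
  (forall i, exists2 h : I -> Y, injective h & forall j, L i (h j)) ->
  exists2 x : I -> Y, injective x & forall i, L i (x i).
Proof.
move=> Lbig; have [R [Rwf Rtot Rinit]] := initial_well_order I.
pose step i (x : forall j, R j i -> Y) : Y :=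
  xget y0 [set y | L i y /\ forall j (ji : R j i), x j ji <> y].
pose x := Fix Rwf (fun=> Y) step.
have xE i : x i = step i (fun j _ => x j).
  apply: (Fix_eq Rwf (fun=> Y)) => {}i f g fg; congr step.
  by apply/functional_extensionality_dep => j; apply/functional_extensionality_dep.
have xP i : L i (x i) /\ forall j, R j i -> x j <> x i.
  rewrite xE; apply: (@xgetPex _ y0 [set y | L i y /\ forall j, R j i -> x j <> y]).
  apply: contrapT => nex; apply: (Rinit i).
  have [h hI hL] := Lbig i.
  have kP j : exists l, R l i /\ x l = h j.
    apply: contrapT => nl; apply: nex; exists (h j); split=> // l li xl.
    by apply: nl; exists l.
  have [k kE] := choice kP; exists k => [j l kjl|j]; last exact: (kE j).1.
  by apply: hI; rewrite -(kE j).2 -(kE l).2 kjl.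
exists x => [i j xij|i]; last exact: (xP i).1.
apply: contrapT => /Rtot[ij|ji].
  exact: (xP j).2 ij xij.
by apply: (xP i).2 ji _.
Qed.

(** 2^c to the power omega is 2^c. *)
Lemma family_embedding : exists code : (nat -> set (set nat)) -> set (set nat),
  injective code.
Proof.
(* The only even element of enc c Z determines c. *)
pose enc c (Z : set nat) : set nat :=
  [set x | x = c.*2 \/ exists2 z, Z z & x = z.*2.+1].
have enc_inj c c' Z Z' : enc c Z = enc c' Z' -> c = c' /\ Z = Z'.
  move=> /seteqP[sub sup]; split.
    have [|/double_inj //|[z _]] := sub c.*2; first by left.
    by move/(congr1 odd); rewrite /= !odd_double.
  apply/seteqP; split=> z Zz.
    have [|/(congr1 odd)|[z' Z'z' [/double_inj ->]] //] := sub z.*2.+1.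
      by right; exists z.
    by rewrite /= !odd_double.
  have [|/(congr1 odd)|[z' Z'z' [/double_inj ->]] //] := sup z.*2.+1.
    by right; exists z.
  by rewrite /= !odd_double.
exists (fun w => [set T | exists c Z, T = enc c Z /\ w c Z]).
move=> w w' /seteqP[ww' w'w].
apply/funext => c; apply/seteqP; split=> Z wZ.
  have [|c' [Z' [/enc_inj[<- <-]] //]] := ww' (enc c Z).
  by exists c, Z.
have [|c' [Z' [/enc_inj[<- <-]] //]] := w'w (enc c Z).
by exists c, Z.
Qed.

(** (n, k, M, f): a point of P n is wanted among the limits of f on [M]^k. *)
Definition request : Type := nat * nat * set nat * ({fset nat} -> beta_omega).

Lemma request_embedding : exists code : request -> set (set nat), injective code.
Proof.
have [code codeI] := family_embedding.
pose w (i : request) c : set (set nat) := let: (n, k, M, g) := i in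
  match c with
  | 0 => [set [set n]]
  | 1 => [set [set k]]
  | 2 => [set M]
  | c'.+3 => if choice.unpickle c' is Some s then mem_beta (g s) else set0
  end.
exists (code \o w); apply: inj_comp => // -[[[n k] M] g] [[[n' k'] M'] g'] ww'.
have wE c := congr1 (@^~ c) ww'.
have set1I (T : Type) (x y : T) : [set x] = [set y] -> x = y.
  by move=> /seteqP[/(_ x erefl)].
have -> : n = n' by exact: (set1I _ _ _ (set1I _ [set n] [set n'] (wE 0))).
have -> : k = k' by exact: (set1I _ _ _ (set1I _ [set k] [set k'] (wE 1))).
have -> : M = M' by exact: (set1I _ _ _ (wE 2)).
congr (_, _); apply/funext => s; have := wE (choice.pickle s).+3.
by rewrite /= choice.pickleK => gg'; apply: beta_omega_eqP; rewrite gg'.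
Qed.

(** By labelled_power_lim, f has as many power limits as there are free
ultrafilters containing M; one of them is required to be in P. *)
Definition catches_limits (P : set beta_omega) :=
  forall k (M : set nat) f, infinite_set M -> labelled M k f ->
    exists p, [/\ free_ultrafilter (mem_beta p), mem_beta p M &
      P (power_lim p k f)].

Lemma bernstein_limits : exists P : nat -> set beta_omega,
  (forall m n x, P m x -> P n x -> m = n) /\ forall n, catches_limits (P n).
Proof.
pose L (i : request) : set beta_omega := let: (n, k, M, f) := i in
  [set x | infinite_set M -> labelled M k f ->
    exists p, [/\ free_ultrafilter (mem_beta p), mem_beta p M &
      power_lim p k f = x]].
have [code codeI] := request_embedding.
have [i|x xI xL] :=
    @distinct_representatives request beta_omega L (beta_principal 0).
  case: i => [[[n k] M] f].
  have [[Minf Mf]|nM] := pselect (infinite_set M /\ labelled M k f); last first.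
    have [u [uI _ _]] := independent_points infinite_nat.
    by exists (u \o code); [exact: inj_comp|move=> j Minf Mf; case: nM].
  have [u [uI ufree uM]] := independent_points Minf.
  exists (fun j => power_lim (u (code j)) k f) => [i j|j _ _]; last first.
    by exists (u (code j)).
  by move=> /labelled_power_lim uij; apply/codeI/uI/(uij M).
exists (fun n => [set y | exists k M f, y = x (n, k, M, f)]); split.
  by move=> m n y [k [M [f ->]]] [k' [M' [f' /xI[]]]].
move=> n k M f Minf Mf.
have [p [pf pM pE]] := xL (n, k, M, f) Minf Mf.
by exists p; split=> //; exists k, M, f.
Qed.

(** * The space *)

Lemma power_filterS (p : beta_omega) (M : set nat) k (A A' : set {fset nat}) :
  A `<=` A' -> A' `<=` ksubsets M k ->
  power_filter (mem_beta p) M k A -> power_filter (mem_beta p) M k A'.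
Proof.
elim: k M A A' => [|k IH] M A A' AA' A'M /=.
  move=> A0; apply/seteqP; split=> [s /A'M[_ /eqP]|_ ->].
    by rewrite cardfs_eq0 => /eqP.
  by apply: AA'; rewrite A0.
move=> [_ pA]; split=> //; apply: filterS pA => m [Mm mA]; split=> //.
by apply: IH mA => s [sM // ms]; split=> //; exact: AA'.
Qed.

Lemma set_type_nbhsP (X : set beta_omega) (x : set_type X) (U : set (set_type X)) :
  nbhs x U <-> exists2 A, mem_beta (set_val x) A &
    forall y : set_type X, mem_beta (set_val y) A -> U y.
Proof.
split=> [|[A xA AU]].
  rewrite nbhsE => -[B [[V oV <-] xV] BU].
  have /nbhs_beta_omega[A xA AV] : nbhs (set_val x : beta_omega) V.
    exact: open_nbhs_nbhs.
  by exists A => // y yA; apply: BU; exact: AV.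
apply: (filterS AU).
apply: (@initial_continuous _ _ (set_val : set_type X -> beta_omega) x
  (clopen_of A)).
by apply/nbhs_beta_omega; exists A.
Qed.

Definition code_max (x : nat) : nat :=
  if choice.unpickle x is Some s then \max_(i <- (s : {fset nat})) i else 0.

Lemma code_maxE n m : (n < m)%N -> code_max (choice.pickle [fset n; m]%fset) = m.
Proof.
move=> nm; rewrite /code_max choice.pickleK; apply/eqP; rewrite eqn_leq.
apply/andP; split; last by apply: leq_bigmax_seq; rewrite // !inE eqxx orbT.
apply/bigmax_leqP_seq => i; rewrite !inE => /orP[]/eqP-> // _; exact: ltnW.
Qed.

Definition column n : set nat :=
  [set x | exists2 m, (n < m)%N & x = choice.pickle [fset n; m]%fset].

Lemma column_disjoint n n' x : column n x -> column n' x -> n = n'.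
Proof.
move=> [m nm ->] [m' nm' /[dup] E /(congr1 code_max)].
rewrite !code_maxE // => mm'; move: E; rewrite -{}mm' in nm' * => E.
have : n \in [fset n'; m]%fset.
  by rewrite -(pcan_inj choice.pickleK E) !inE eqxx.
by rewrite !inE => /orP[/eqP//|/eqP nE]; rewrite nE ltnn in nm.
Qed.

Definition column_space (P : nat -> set beta_omega) : set beta_omega :=
  [set x | forall n, mem_beta x (column n) ->
    (exists a, beta_map code_max x = beta_principal a) \/
    P n (beta_map code_max x)].

Lemma column_space_principal P a : column_space P (beta_principal a).
Proof.
move=> n _; left; exists (code_max a); apply: beta_omega_eqP => A.
by move=> /principal_filterP Aa; exact/principal_filterP.
Qed.

Lemma column_uniq (x : beta_omega) n n' :
  mem_beta x (column n) -> mem_beta x (column n') -> n = n'.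
Proof.
by move=> xn xn'; have [a []] := filter_ex (filterI xn xn'); exact: column_disjoint.
Qed.

Lemma power_lim_const (p : beta_omega) (M : set nat) k f y :
  free_ultrafilter (mem_beta p) -> mem_beta p M ->
  (forall s, ksubsets M k s -> f s = y) -> power_lim p k f = y.
Proof.
move=> pf pM fy; apply/esym/beta_omega_eqP => A yA.
by apply: (power_lim_mem pf pM) => s /fy ->.
Qed.

(** Colour s by the column that f s contains, if any, and apply the dichotomy to
the colouring.  If the colour is constant on [M]^k, either no f s contains a
column, and then neither does the limit, or all f s contain column n, and the
dichotomy applies to the images of f s under code_max.  If the colour is
labelled by b, then colour c occurs only at sets s containing b c, hence not on
[M `\` [set b c]]^k, and the limit contains no column. *)
Lemma column_space_limit P k (f : {fset nat} -> beta_omega) :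
  (forall n, catches_limits (P n)) ->
  (forall s, ksubsets setT k s -> column_space P (f s)) ->
  exists2 p, free_ultrafilter (mem_beta p) & column_space P (power_lim p k f).
Proof.
move=> P_limits fX.
have off_columns (p : beta_omega) : free_ultrafilter (mem_beta p) ->
    (forall n, exists2 M, mem_beta p M &
      forall s, ksubsets M k s -> ~ mem_beta (f s) (column n)) ->
    column_space P (power_lim p k f).
  move=> pf pM n limn; have [M pMn Mn] := pM n; exfalso.
  have : mem_beta (power_lim p k f) (~` column n).
    by apply: (power_lim_mem pf pMn) => s /Mn /mem_beta_setC.
  by move=> /mem_beta_setC; apply.
(* Colour 0 stands for no column, colour n.+1 for column n. *)
have cP x : exists c, (forall n, mem_beta x (column n) <-> c = n.+1).
  have [[n xn]|nx] := pselect (exists n, mem_beta x (column n)).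
    exists n.+1 => n'; split=> [xn'|[<-]] //.
    by rewrite (column_uniq xn xn').
  by exists 0 => n; split=> // xn; case: nx; exists n.
have [c cE] := choice cP.
have free_on M : infinite_set M ->
    exists2 p, free_ultrafilter (mem_beta p) & mem_beta p M.
  move=> /independent_points[u [_ uf uM]]; exists (u set0) => //; exact: uM.
have [M [_ Minf]] :=
  constant_or_labelled k (fun s => beta_principal (c (f s))) infinite_nat.
case=> [[y yE]|[b bE]]; last first.
  have [p pf pM] := free_on M Minf.
  exists p => //; apply: off_columns => // n.
  exists (M `&` ~` [set b n.+1]) => [|s sM].
    by apply: filterI => //; apply: free_cofinite.
  move=> /cE csn; have sM' : ksubsets M k s by apply: ksubsetsS sM => m [].
  have /principal_filterP := bE s sM'; rewrite csn /= => bs.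
  by case: sM => + _ => /(_ _ bs)[_]; apply.
have [s0 s0M] := ksubsets_exists k Minf.
have cs0 s : ksubsets M k s -> c (f s) = c (f s0).
  by move=> sM; apply: beta_principal_inj; rewrite !yE.
have [[n s0n]|ns0] :=
  pselect (exists n, mem_beta (f s0) (column n)); last first.
  have [p pf pM] := free_on M Minf.
  exists p => //; apply: off_columns => // n; exists M => // s /cs0 css0 /cE.
  by rewrite css0 => /cE ?; apply: ns0; exists n.
have sn s : ksubsets M k s -> mem_beta (f s) (column n).
  by move=> /cs0 css0; apply/cE; rewrite css0; exact/cE.
have in_column (p : beta_omega) : free_ultrafilter (mem_beta p) -> mem_beta p M ->
    (exists a, power_lim p k (beta_map code_max \o f) = beta_principal a) \/
    P n (power_lim p k (beta_map code_max \o f)) ->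
    column_space P (power_lim p k f).
  move=> pf pM plim n' limn'; have limn := power_lim_mem pf pM sn.
  by rewrite -(column_uniq limn limn') beta_map_power_lim.
have [M' [M'M M'inf M'P]] :=
  constant_or_labelled k (beta_map code_max \o f) Minf.
case: M'P => [[z zE]|M'lab].
  have [p pf pM'] := free_on M' M'inf.
  exists p => //; apply: in_column => //; first exact: filterS pM'.
  rewrite (power_lim_const pf pM' zE).
  have [s sM'] := ksubsets_exists k M'inf.
  by rewrite -(zE s sM'); apply: fX; [case: sM'|exact/sn/(ksubsetsS M'M)].
have [p [pf pM' Pn]] := P_limits n k M' _ M'inf M'lab.
by exists p => //; apply: in_column => //; [exact: filterS pM'|right].
Qed.

Lemma column_space_countably_compact P k : (forall n, catches_limits (P n)) ->
  k_countably_compact k (set_type (column_space P)).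
Proof.
move=> P_limits f.
pose g s : beta_omega :=
  if pselect (ksubsets setT k s) is left sk then
    set_val (f (SigSub (mem_set sk)))
  else beta_principal 0.
have gE (s : {fset nat}) (sk : ksubsets setT k s) :
    g s = set_val (f (SigSub (mem_set sk))).
  rewrite /g; case: pselect => // sk'.
  by rewrite (Prop_irrelevance sk sk').
have [s sk|p pf pX] := @column_space_limit P k g P_limits.
  by rewrite gE; exact: set_valP.
exists (mem_beta p), (SigSub (mem_set pX)); split=> // U.
move=> /set_type_nbhsP[A /= xA AU].
have [+ _] := @power_limE p setT A k g pf filterT.
move=> /(_ xA); apply: power_filterS => [s [sk gsA]|_ [s _ <-]]; last exact: set_valP.
exists (SigSub (mem_set sk)) => //=; apply: AU.
by rewrite -gE.
Qed.

(** For n in A, the image under code_max of the n-th limit is the free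
ultrafilter itself, which is therefore in P n. *)
Lemma column_space_not_cascade P : (forall m n x, P m x -> P n x -> m = n) ->
  ~ two_cascade_countably_compact (set_type (column_space P)).
Proof.
move=> P_disjoint.
pose f (s : ksubsets setT 2) : set_type (column_space P) :=
  SigSub (mem_set (@column_space_principal P (choice.pickle (set_val s)))).
move=> /(_ f)[p [A [y [x [[pU pfree] pA yP _]]]]].
pose q := BetaOmega pU.
have qfree : free_ultrafilter (mem_beta q) by [].
have mem_y (n : A) B : mem_beta (set_val (y n)) B ->
    mem_beta q [set m | (set_val n < m)%N /\
      B (choice.pickle [fset (set_val n); m]%fset)].
  move=> yB; have /yP : nbhs (y n) [set z | mem_beta (set_val z) B].
    by apply/set_type_nbhsP; exists B.
  apply: (@filterS _ p) => _ [m mB <-]; split; first exact: set_valP m.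
  by move: mB; rewrite /= => /principal_filterP.
have Pq n : A n -> P n q.
  move=> An; pose n' : A := SigSub (mem_set An).
  have ncol : mem_beta (set_val (y n')) (column n).
    apply: contrapT => /mem_beta_setC /mem_y /filter_ex[m [/= nm]]; apply.
    by exists m.
  have yq : beta_map code_max (set_val (y n')) = q.
    apply: beta_omega_eqP => B /mem_y; apply: filterS => m [/= nm].
    by rewrite code_maxE.
  have [[a qa]|//] : (exists a, q = beta_principal a) \/ P n q.
    by rewrite -yq; exact: (set_valP (y n') n ncol).
  have /mem_beta_setC[] := free_cofinite qfree (finite_set1 a).
  by rewrite qa; exact/principal_filterP.
have [n An] := filter_ex pA.
have [n' [An' nn']] := filter_ex (filterI pA (free_cofinite qfree (finite_set1 n))).
by apply: nn'; exact: P_disjoint (Pq _ An') (Pq _ An).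
Qed.

Theorem proposition4p7 :
  exists X : set beta_omega,
    (forall k : nat, k_countably_compact k (set_type X)) /\
    ~ two_cascade_countably_compact (set_type X).
Proof.
have [P [P_disjoint P_limits]] := bernstein_limits.
exists (column_space P); split=> [k|].
  exact: column_space_countably_compact.
exact: column_space_not_cascade P_disjoint.
Qed.
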